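(* If $(a_n)_{n=0}^{\infty}$ is a greedy $1$-energy sequence ($s=1$) on $S^1$, then $$\lim_{N\to\infty}\frac{U_{N,1}(a_N)}{N\log N}=\frac{1}{\pi}.$$
   Context: $S^1=\{z\in\mathbb{C}:|z|=1\}$. A sequence $(a_n)_{n=0}^{\infty}\subset S^1$ is a greedy $1$-energy sequence on $S^1$ if for every $n\geq 1$, $\sum_{k=0}^{n-1}|a_n-a_k|^{-1}=\inf_{z\in S^1}\sum_{k=0}^{n-1}|z-a_k|^{-1}$ (with $|z-a_k|^{-1}=+\infty$ when $z=a_k$). For $N\geq 1$, $U_{N,1}(z):=\sum_{k=0}^{N-1}|z-a_k|^{-1}$. *)

(* Defs.v *)
From HB Require Import structures.
From mathcomp Require Import all_boot all_order all_algebra.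
From mathcomp Require Import all_classical all_reals all_analysis.
From mathcomp Require Import complex.

Set Implicit Arguments.
Unset Strict Implicit.
Unset Printing Implicit Defensive.

Import Order.TTheory GRing.Theory Num.Theory.
Import numFieldNormedType.Exports.

Local Open Scope classical_set_scope.
Local Open Scope ring_scope.

(* The norm of MathComp on R[i] takes its values in R[i]; the R-valued modulus
   is ComplexField.Normc.normc. *)
Definition unit_circle (R : realType) : set R[i] :=
  [set z | ComplexField.Normc.normc z = 1 :> R].

(* The inverse is the one of \bar R, for which 0^-1 = +oo. *)
Definition potential1 (R : realType) (a : nat -> R[i]) (N : nat) (z : R[i])
    : \bar R :=
  (\sum_(k < N) ((ComplexField.Normc.normc (z - a k) : R)%:E)^-1)%E.

Definition greedy_1_energy_sequence (R : realType) (a : nat -> R[i]) : Prop :=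
  (forall n : nat, unit_circle (a n)) /\
  (forall n : nat, (1 <= n)%N ->
     potential1 a n (a n) =
     ereal_inf [set potential1 a n z | z in unit_circle (R := R)]).

(* Main.v *)
Require Import Defs.
From HB Require Import structures.
From mathcomp Require Import all_boot all_order all_algebra.
From mathcomp Require Import all_classical all_reals all_analysis.
From mathcomp Require Import complex.
From mathcomp Require Import lra ring.
Import Order.TTheory GRing.Theory Num.Theory.
Import numFieldNormedType.Exports.

Set Implicit Arguments.
Unset Strict Implicit.
Unset Printing Implicit Defensive.

Local Open Scope classical_set_scope.
Local Open Scope ring_scope.

(** A greedy sequence on the circle has a rigid dyadic structure, which turns
    its greedy values into an explicit sum over the binary digits of N.

    Write the points as a_k = exp (2 i t_k), so that |a_j - a_k| is
    2 |sin (t_j - t_k)|.  The potential of the M-th roots of unity becomes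
    P_M(x) = sum_(j < M) 1 / (2 |sin (x + j pi / M)|), which has period
    h = pi / M.  On ]0, h[ every summand is a strictly convex function of x and
    P_M is symmetric about h / 2, so P_M is minimal exactly on h / 2 + h Z
    ([roots_potential_min]).

    By induction on n, the first 2^n points of a greedy sequence are, up to
    order, a rotated copy of the 2^n-th roots of unity.  Indeed, with M = 2^n
    and the first M points known to be such a copy, the point t_M sits at a
    midpoint, and the points t_M, t_(M+1), ... form a greedy sequence of their
    own for as long as at most M of them are taken: by induction the potential
    of these points alone is minimised only on the grid t_M + h Z, where P_M
    is minimal as well, so that a minimiser of the sum of the two potentials
    must minimise both.  The two blocks interlace into the 2M-th roots of unity
    because P_M(x) + P_M(x + h / 2) = P_(2M)(x).

    The same argument shows that the minimal value for M + K points, K < M, is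
    P_M(h / 2) plus the minimal value for K points.
    Now P_M(h / 2) = M ln M / pi + O(M), because 1 / sin x differs from
    1 / x + 1 / (pi - x) by a bounded amount and the poles produce the odd
    harmonic sum ([midpoint_value_asymp]), and the defect of additivity of
    x ln x is O(M).  Each error is linear in the size of its block and the blocks
    add up to N, so the greedy value is N ln N / pi + O(N) ([greedy_value_asymp]). *)

(** * Bounds and convexity for the cosecant *)

Lemma sin_mean_value (R : realType) (x : R) : 0 <= x ->
  exists2 c, 0 <= c <= x & sin x = x * cos c.
Proof.
move=> x0.
have [|c] := MVT_segment x0 (f := sin) (df := cos).
  by apply: continuous_subspaceT => y; exact: continuous_sin.
by rewrite in_itv /= sin0 !subr0 => c0x ->; exists c => //; rewrite mulrC.
Qed.

Lemma sin_le_id (R : realType) (x : R) : 0 <= x -> sin x <= x.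
Proof.
move=> x0; have [c _ ->] := @sin_mean_value R x x0.
by rewrite ler_piMr // cos_le1.
Qed.

Lemma mulcos_le_sin (R : realType) (x : R) : 0 <= x <= pi -> x * cos x <= sin x.
Proof.
move=> /andP[x0 xpi]; have [c /andP[c0 cx] ->] := @sin_mean_value R x x0.
rewrite ler_wpM2l //; move: cx; rewrite le_eqVlt => /predU1P[->//|cx].
by rewrite ltW // ltr_cos // in_itv /= ?c0 ?x0 //= (le_trans (ltW cx)).
Qed.

Lemma sinBpi (R : realType) (x : R) : sin (pi - x) = sin x.
Proof. by rewrite sinB sinpi cospi; ring. Qed.

(** With x = 2 y, the claim 1 / sin x - 1 / x <= 1 / 2 follows from
    y cos y <= sin y <= cos y, the second inequality being y <= pi / 4. *)
Lemma csc_le_pole (R : realType) (x : R) : 0 < x <= pi / 2 ->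
  (sin x)^-1 <= x^-1 + 1 / 2.
Proof.
move=> /andP[x0 xpi]; have pi0 := pi_gt0 R.
have s0 : 0 < sin x by apply: sin_gt0_pi; apply/andP; split=> //; lra.
have sle : sin x <= x by apply: sin_le_id; exact: ltW.
set y := x / 2.
have xE : x = y *+ 2 by rewrite /y; lra.
have y0 : 0 < y by rewrite /y; lra.
have c0 : 0 < cos y by apply: cos_gt0_pihalf; apply/andP; split; rewrite /y; lra.
have sy0 : 0 < sin y.
  by apply: sin_gt0_pi; apply/andP; split=> //; rewrite /y; lra.
have yc : y * cos y <= sin y
  by apply: mulcos_le_sin; apply/andP; split; rewrite /y; lra.
have sE : sin x = 2 * (cos y * sin y) by rewrite xE sin_mulr2n; lra.
have cs := cos2Dsin2 y.
have sc : sin y <= cos y.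
  have : 0 <= cos x by apply: cos_ge0_pihalf; apply/andP; split; lra.
  rewrite xE cos_mulr2n => h.
  rewrite -(@ler_pXn2r _ 2) ?nnegrE //; [lra|exact: ltW|exact: ltW].
rewrite -(@ler_pM2l _ (x * sin x)) ?mulr_gt0 //.
have -> : x * sin x / sin x = x by field; rewrite gt_eqF.
have -> : x * sin x * (x^-1 + 1 / 2) = sin x + x * sin x / 2
  by field; rewrite gt_eqF.
(* this is y <= cos y sin y + y cos y sin y, and the left-hand side splits as
   y cos^2 y + y sin^2 y *)
have h1 : y * cos y * cos y <= sin y * cos y by rewrite ler_pM2r.
have h2 : y * sin y * sin y <= y * sin y * cos y
  by rewrite ler_wpM2l // mulr_ge0 // ltW.
have h3 : y = y * cos y * cos y + y * sin y * sin y.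
  by rewrite -[LHS]mulr1 -cs; ring.
rewrite sE xE; lra.
Qed.

(** The symmetry x |-> pi - x reduces this to x <= pi / 2, where the second pole
    contributes at most 2 / pi. *)
Lemma csc_two_poles (R : realType) (x : R) : 0 < x < pi ->
  `|(sin x)^-1 - (x^-1 + (pi - x)^-1)| <= 1.
Proof.
wlog xpi : x / x <= pi / 2.
  move=> hw /andP[x0 xpi]; have [?|hx] := leP x (pi / 2).
    by apply: hw => //; rewrite x0.
  have := hw (pi - x); rewrite sinBpi subKr [_^-1 + _^-1]addrC; apply.
    by lra.
  by apply/andP; split; lra.
move=> /andP[x0 _]; have pi2 := pi_ge2 R.
have s0 : 0 < sin x by apply: sin_gt0_pi; apply/andP; split=> //; lra.
have h1 : (sin x)^-1 <= x^-1 + 1 / 2 by apply: csc_le_pole; rewrite x0.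
have h2 : x^-1 <= (sin x)^-1.
  by rewrite lef_pV2 ?posrE //; apply: sin_le_id; exact: ltW.
have h3 : 0 <= (pi - x)^-1 by rewrite invr_ge0; lra.
have h4 : (pi - x)^-1 <= 1 by rewrite invf_le1; lra.
by rewrite ler_norml; apply/andP; split; lra.
Qed.

Lemma sin_midpoint (R : realType) (x y : R) :
  sin x + sin y = 2 * (sin ((x + y) / 2) * cos ((x - y) / 2)).
Proof.
have -> : sin x = sin ((x + y) / 2 + (x - y) / 2) by congr sin; lra.
have -> : sin y = sin ((x + y) / 2 - (x - y) / 2) by congr sin; lra.
by rewrite sinD sinB; ring.
Qed.

(** Strict midpoint convexity: the harmonic mean of sin x and sin y is at most
    their arithmetic mean sin ((x + y) / 2) cos ((x - y) / 2). *)
Lemma csc_midpoint_strict (R : realType) (x y : R) : 0 < x < pi -> 0 < y < pi ->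
  x != y -> 2 * (sin ((x + y) / 2))^-1 < (sin x)^-1 + (sin y)^-1.
Proof.
move=> hx hy xy; have sx := sin_gt0_pi hx; have sy := sin_gt0_pi hy.
have sm : 0 < sin ((x + y) / 2).
  by apply: sin_gt0_pi; move/andP: hx => [? ?]; move/andP: hy => [? ?];
     apply/andP; split; lra.
have c1 : cos ((x - y) / 2) < 1.
  rewrite -cos_norm -[X in _ < X]cos0 ltr_cos ?in_itv /= ?lexx ?pi_ge0 //.
    by rewrite normr_gt0 mulf_neq0 ?subr_eq0 // invr_eq0.
  rewrite normr_ge0 /= ler_norml.
  move/andP: hx => [? ?]; move/andP: hy => [? ?]; apply/andP; split; lra.
have slt : sin x + sin y < 2 * sin ((x + y) / 2).
  rewrite sin_midpoint ltr_pM2l // -[X in _ < X]mulr1 ltr_pM2l //.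
have am : 4 * (sin x + sin y)^-1 <= (sin x)^-1 + (sin y)^-1.
  rewrite -subr_ge0.
  have -> : (sin x)^-1 + (sin y)^-1 - 4 * (sin x + sin y)^-1 =
    (sin x - sin y) ^+ 2 / (sin x * sin y * (sin x + sin y)).
    by field; rewrite !gt_eqF // addr_gt0.
  by rewrite divr_ge0 ?sqr_ge0 // !mulr_ge0 // ltW // addr_gt0.
apply: lt_le_trans am.
have -> : 4 * (sin x + sin y)^-1 = 2 * ((sin x + sin y) / 2)^-1.
  by field; rewrite gt_eqF // addr_gt0.
rewrite ltr_pM2l // ltf_pV2 ?posrE // ?divr_gt0 ?addr_gt0 //.
by lra.
Qed.

(** * The potential of the roots of unity *)

(** The reciprocal distance between two points of the circle whose half-angles
    differ by x. *)
Definition inv_chord (R : realType) (x : R) : \bar R := ((2 * `|sin x|)%:E)^-1%E.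

(** The potential of the M-th roots of unity at exp (2 i x). *)
Definition roots_potential (R : realType) (M : nat) (x : R) : \bar R :=
  (\sum_(j < M) inv_chord (x + j%:R * (pi / M%:R))%R)%E.

Lemma inv_chord_ge0 (R : realType) (x : R) : (0 <= inv_chord x)%E.
Proof. by rewrite /inv_chord inve_ge0 lee_fin mulr_ge0. Qed.

Lemma inv_chordDpi (R : realType) (x : R) : inv_chord (x + pi) = inv_chord x.
Proof. by rewrite /inv_chord sinDpi normrN. Qed.

Lemma inv_chord_fin (R : realType) (x : R) : 0 < x < pi ->
  inv_chord x = ((2 * sin x)^-1)%:E.
Proof.
move=> /sin_gt0_pi s0; rewrite /inv_chord inver gtr0_norm //.
by rewrite mulf_eq0 pnatr_eq0 /= gt_eqF.
Qed.

Lemma roots_potential_period (R : realType) (M : nat) (x : R) : (0 < M)%N ->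
  roots_potential M (x + pi / M%:R) = roots_potential M x.
Proof.
case: M => // m _; rewrite /roots_potential big_ord_recr big_ord_recl /= addeC.
congr (_ + _)%E.
  rewrite -[in RHS]inv_chordDpi; congr inv_chord; rewrite -natr1.
  by field; rewrite natr1 pnatr_eq0.
apply: eq_bigr => j _; congr inv_chord; rewrite /bump add1n -[j.+1%:R]natr1.
by ring.
Qed.

Lemma roots_potential_periodn (R : realType) (M : nat) (x : R) (k : nat) :
  (0 < M)%N ->
  roots_potential M (x + k%:R * (pi / M%:R)) = roots_potential M x.
Proof.
move=> M0; elim: k => [|k IH]; first by rewrite mul0r addr0.
by rewrite -natr1 mulrDl mul1r addrA roots_potential_period.
Qed.

Lemma roots_potential_periodz (R : realType) (M : nat) (x : R) (k : int) :
  (0 < M)%N ->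
  roots_potential M (x + k%:~R * (pi / M%:R)) = roots_potential M x.
Proof.
move=> M0; case: k => k; first exact: roots_potential_periodn.
rewrite NegzE mulrNz mulNr -[LHS](@roots_potential_periodn R M _ k.+1) //.
congr roots_potential.
by rewrite -addrA addNr addr0.
Qed.

Lemma big_even_odd (T : Type) (idx : T) (op : Monoid.com_law idx)
    (F : nat -> T) (M : nat) :
  \big[op/idx]_(j < M.*2) F j =
  op (\big[op/idx]_(j < M) F j.*2) (\big[op/idx]_(j < M) F j.*2.+1).
Proof.
elim: M => [|M IH]; first by rewrite !big_ord0 Monoid.mul1m.
by rewrite doubleS !big_ord_recr /= IH -Monoid.mulmA Monoid.mulmACA.
Qed.

(** The 2M-th roots of unity are the M-th roots and their half-step rotation. *)
Lemma roots_potential_double (R : realType) (M : nat) (x : R) : (0 < M)%N ->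
  roots_potential M.*2 x =
  (roots_potential M x + roots_potential M (x + pi / M.*2%:R))%E.
Proof.
move=> M0; have Mn : M%:R != 0 :> R by rewrite pnatr_eq0 -lt0n.
rewrite /roots_potential.
rewrite (big_even_odd _ (fun j => inv_chord (x + j%:R * (pi / M.*2%:R)))).
by congr (_ + _)%E; apply: eq_bigr => j _; congr inv_chord;
  rewrite -?[_.+1%:R]natr1 -!mul2n !natrM; field.
Qed.

(** Between two consecutive poles of [roots_potential M] all the sines have their
    argument in ]0, pi[, so absolute values and infinite values disappear. *)
Definition roots_potentialR (R : realType) (M : nat) (x : R) : R :=
  \sum_(j < M) (2 * sin (x + j%:R * (pi / M%:R)))^-1.

Lemma phase_bounds (R : realType) (M : nat) (x : R) (j : 'I_M) :
  0 < x < pi / M%:R -> 0 < x + j%:R * (pi / M%:R) < pi.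
Proof.
move=> /andP[x0 xM]; have pi0 := pi_gt0 R.
have M0 : 0 < M%:R :> R by rewrite ltr0n (leq_ltn_trans _ (ltn_ord j)).
have h0 : 0 < pi / M%:R :> R by rewrite divr_gt0.
have jh : 0 <= j%:R * (pi / M%:R) :> R by rewrite mulr_ge0 // ltW.
rewrite ltr_pwDl //=.
have : (j%:R + 1) * (pi / M%:R) <= M%:R * (pi / M%:R) :> R.
  by rewrite ler_pM2r // natr1 ler_nat.
have -> : M%:R * (pi / M%:R) = pi :> R by field; rewrite gt_eqF.
by lra.
Qed.

Lemma roots_potential_fin (R : realType) (M : nat) (x : R) : 0 < x < pi / M%:R ->
  roots_potential M x = (roots_potentialR M x)%:E.
Proof.
move=> hx; rewrite /roots_potential /roots_potentialR -sumEFin.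
apply: eq_bigr => j _.
by rewrite inv_chord_fin // phase_bounds.
Qed.

Lemma roots_potentialR_reflect (R : realType) (M : nat) (x : R) :
  roots_potentialR M (pi / M%:R - x) = roots_potentialR M x.
Proof.
rewrite /roots_potentialR (reindex_inj rev_ord_inj) /=; apply: eq_bigr => j _.
congr (2 * _)^-1; rewrite -sinBpi; congr sin.
have Mn : M%:R != 0 :> R by rewrite pnatr_eq0 -lt0n (leq_ltn_trans _ (ltn_ord j)).
by rewrite natrB // -natr1; field.
Qed.

(** Averaging x with its mirror image pi / M - x puts every summand at the
    midpoint, where strict convexity makes it smaller. *)
Lemma roots_potentialR_min (R : realType) (M : nat) (x : R) : (0 < M)%N ->
  0 < x < pi / M%:R -> x != pi / M%:R / 2 ->
  roots_potentialR M (pi / M%:R / 2) < roots_potentialR M x.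
Proof.
move=> M0 hx xn; rewrite -(@ltr_pM2l _ 2) // mulr_natl [X in _ < X]mulr_natl.
rewrite [X in _ < X]mulr2n -[X in _ < X + _]roots_potentialR_reflect -mulr_natl.
rewrite /roots_potentialR mulr_sumr -big_split /=.
apply: ltr_sum => [|j _].
  by apply/hasP; exists (Ordinal M0); rewrite ?mem_index_enum.
have hx' : 0 < pi / M%:R - x < pi / M%:R.
  by move/andP: hx => [? ?]; apply/andP; split; lra.
have := csc_midpoint_strict (phase_bounds j hx') (phase_bounds j hx).
rewrite !invfM; set u := sin _; set v := sin _; set w := sin _.
rewrite [u](_ : _ = sin (pi / M%:R / 2 + j%:R * (pi / M%:R))); last first.
  rewrite /u; congr (sin _); field.
  by rewrite pnatr_eq0 -lt0n.
move=> h; have {}h := h _.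
have : pi / M%:R - x + j%:R * (pi / M%:R) != x + j%:R * (pi / M%:R).
  apply: contra xn => /eqP e; apply/eqP; lra.
move=> /h; lra.
Qed.

Lemma roots_potential_pole (R : realType) (M : nat) : (0 < M)%N ->
  roots_potential M (0 : R) = +oo%E.
Proof.
case: M => // m _; rewrite /roots_potential big_ord_recl /= mul0r addr0.
rewrite {1}/inv_chord sin0 normr0 mulr0 inve0 addye //.
rewrite gt_eqF // (lt_le_trans ltNy0) // sume_ge0 // => j _.
exact: inv_chord_ge0.
Qed.

(** Periodicity brings x into [0, pi / M[, where 0 is a pole and the rest is
    [roots_potentialR_min]. *)
Lemma roots_potential_min (R : realType) (M : nat) (x : R) : (0 < M)%N ->
  ((roots_potentialR M (pi / M%:R / 2 : R))%:E <= roots_potential M x)%E /\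
  (roots_potential M x = (roots_potentialR M (pi / M%:R / 2 : R))%:E ->
   exists k : int, x = pi / M%:R / 2 + k%:~R * (pi / M%:R)).
Proof.
move=> M0; set h := pi / M%:R.
have h0 : 0 < h by rewrite divr_gt0 ?pi_gt0 // ltr0n.
pose k := Num.floor (x / h); pose y := x - k%:~R * h.
have xE : x = y + k%:~R * h by rewrite subrK.
have y0 : 0 <= y by rewrite subr_ge0 -ler_pdivlMr // floor_le.
have yh : y < h.
  have := floorD1_gt (x / h); rewrite -/k intrD ltr_pdivrMr // /y; lra.
rewrite xE roots_potential_periodz //.
have [ye|yn] := eqVneq y 0.
  by rewrite ye roots_potential_pole // leey; split.
have hy : 0 < y < h by rewrite lt_def yn y0.
rewrite roots_potential_fin //; have [->|yn2] := eqVneq y (h / 2).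
  by split=> // _; exists k.
have := roots_potentialR_min M0 hy yn2; split; first by rewrite lee_fin ltW.
by move=> -[e]; move: H; rewrite e ltxx.
Qed.

(** * Asymptotics of the value at a midpoint *)

Lemma ln_le_subr1 (R : realType) (x : R) : 0 < x -> ln x <= x - 1.
Proof.
by move=> x0; have := @le_ln1Dx R (x - 1); rewrite subrKC; apply; lra.
Qed.

Lemma ln_sub_le (R : realType) (x y : R) : 0 < x -> 0 < y ->
  ln y - ln x <= (y - x) / x.
Proof.
move=> x0 y0; rewrite -ln_div ?posrE //.
apply: le_trans (ln_le_subr1 _) _; first exact: divr_gt0.
by rewrite mulrBl divff // gt_eqF.
Qed.

Lemma odd_harmonic_ge (R : realType) (M : nat) :
  ln (M.+1%:R : R) <= \sum_(j < M) 2 / (2 * j%:R + 1).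
Proof.
elim: M => [|M IH]; first by rewrite big_ord0 ln1.
rewrite big_ord_recr /=.
have m0 : 0 <= M%:R :> R by [].
have := @ln_sub_le R M.+1%:R M.+2%:R; rewrite !ltr0n => /(_ isT isT).
rewrite -[M.+2%:R]natr1 -[M.+1%:R]natr1 in IH *.
have -> : (M%:R + 1 + 1 - (M%:R + 1)) / (M%:R + 1) = (M%:R + 1)^-1 :> R.
  by rewrite [_ + 1 - _]addrC addKr mul1r.
suff : (M%:R + 1)^-1 <= 2 / (2 * M%:R + 1) :> R by lra.
by rewrite ler_pdivlMr ?ler_pdivrMl //; lra.
Qed.

(** The increment of ln from M + 1 to M + 2 is at least 1 / (M + 2), which the
    summand of index M + 2 does not exceed while that of index M + 1 does; hence
    the induction runs with M + 2 terms against ln (M + 1). *)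
Lemma odd_harmonic_le (R : realType) (M : nat) : (0 < M)%N ->
  \sum_(j < M) 2 / (2 * j%:R + 1) <= ln (M%:R : R) + 3.
Proof.
case: M => // -[_|M _]; first by rewrite big_ord1 ln1 /= mulr0 !add0r divr1; lra.
suff : \sum_(j < M.+2) 2 / (2 * j%:R + 1) <= ln (M.+1%:R : R) + 3.
  move=> h; apply: le_trans h _; rewrite lerD2r ler_ln ?posrE ?ltr0n //.
  by rewrite ler_nat.
elim: M => [|M IH].
  rewrite !big_ord_recr big_ord0 /= ln1 mulr0 !add0r divr1.
  by rewrite -lerBrDl ler_pdivrMr; lra.
rewrite big_ord_recr /=.
have m0 : 0 <= M%:R :> R by [].
have := @ln_sub_le R M.+2%:R M.+1%:R; rewrite !ltr0n => /(_ isT isT).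
rewrite -![M.+2%:R]natr1 -![M.+1%:R]natr1 in IH *.
have -> : (M%:R + 1 - (M%:R + 1 + 1)) / (M%:R + 1 + 1) = - (M%:R + 2)^-1 :> R.
  by field; rewrite gt_eqF //; lra.
suff : 2 / (2 * (M%:R + 1 + 1) + 1) <= (M%:R + 2)^-1 :> R by lra.
by rewrite ler_pdivrMr ?ler_pdivlMl //; lra.
Qed.

(** The midpoints are x_j = (2 j + 1) pi / (2 M).  Replacing each cosecant by its
    two poles costs at most 1, and the reflection j |-> M - 1 - j identifies the
    two sums of poles, each being M / pi times the odd harmonic sum. *)
Lemma midpoint_value_asymp (R : realType) (M : nat) : (0 < M)%N ->
  `|roots_potentialR M (pi / M%:R / 2 : R) - M%:R * ln M%:R / pi| <= 2 * M%:R.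
Proof.
move=> M0; have Mp : 0 < M%:R :> R by rewrite ltr0n.
have pi0 := pi_gt0 R; have pi2 := pi_ge2 R.
set h := pi / M%:R; have h0 : 0 < h by rewrite divr_gt0.
pose x (j : 'I_M) : R := h / 2 + j%:R * h.
have xpi j : 0 < x j < pi by
  apply: phase_bounds; apply/andP; split; rewrite -/h; lra.
pose S : R := \sum_(j < M) 2 / (2 * j%:R + 1).
have S1 : \sum_j (x j)^-1 = M%:R / pi * S.
  rewrite mulr_sumr; apply: eq_bigr => j _; rewrite /x /h.
  have j0 : 0 <= j%:R :> R by [].
  (* pi is generalised because [field] would unfold its definition *)
  move: (pi) pi0 (M%:R) Mp => p p0 m m0.
  by field; rewrite !gt_eqF //= ltr_pwDl // !mulr_ge0 // ltW.
have S2 : \sum_j (pi - x j)^-1 = M%:R / pi * S.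
  rewrite -S1 [RHS](reindex_inj rev_ord_inj) /=; apply: eq_bigr => j _.
  congr _^-1; rewrite /x /h /= natrB // -natr1.
  by move: (pi) => p; field; rewrite gt_eqF.
have : `|\sum_j ((sin (x j))^-1 - ((x j)^-1 + (pi - x j)^-1))| <= M%:R.
  apply: le_trans (ler_norm_sum _ _ _) _.
  rewrite -[X in _ <= X%:R]card_ord -sum1_card natr_sum; apply: ler_sum => j _.
  exact: csc_two_poles.
rewrite sumrB big_split /= S1 S2.
have -> : roots_potentialR M (h / 2) = 2^-1 * \sum_j (sin (x j))^-1.
  by rewrite mulr_sumr; apply: eq_bigr => j _; rewrite invfM.
set A := \sum_j _ => hA.
have l1 : ln M%:R <= S.
  apply: le_trans (odd_harmonic_ge R M); rewrite ler_ln ?posrE ?ltr0n //.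
  by rewrite ler_nat.
have l2 : S <= ln M%:R + 3 by exact: odd_harmonic_le.
set q := M%:R / pi in hA *.
have q0 : 0 < q by rewrite divr_gt0.
have q2 : q * 2 <= M%:R by rewrite /q mulrAC ler_pdivrMr // ler_pM2l.
have k1 : q * ln M%:R <= q * S by rewrite ler_pM2l.
have k2 : q * S <= q * (ln M%:R + 3) by rewrite ler_pM2l.
have -> : M%:R * ln M%:R / pi = q * ln M%:R by rewrite /q; ring.
move: hA; rewrite !ler_norml => /andP[a1 a2]; apply/andP; split; lra.
Qed.

(** The constant 3 is the least one that survives the recursion over the binary
    digits in [near_xlnx_block]: a block of size M brings an error 2 M from the
    asymptotics of the midpoint value and M from the superadditivity of x ln x. *)
Definition near_xlnx (R : realType) (N : nat) (v : R) : Prop :=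
  `|v - N%:R * ln N%:R / pi| <= 3 * N%:R.

(** The defect is M ln (1 + K / M) + K ln (1 + M / K), an entropy, and
    ln (1 + u) <= u bounds it by K + M. *)
Lemma xlnx_superadditive (R : realType) (M K : nat) : (K <= M)%N ->
  0 <= (M + K)%:R * ln ((M + K)%:R : R) - M%:R * ln M%:R - K%:R * ln K%:R
    <= 2 * (M%:R : R).
Proof.
case: K => [_|K]; first by rewrite addn0 mul0r subr0 subrr lexx /= mulr_ge0.
set k := K.+1 => kM; have k0 : 0 < k%:R :> R by rewrite ltr0n.
have kM' : k%:R <= M%:R :> R by rewrite ler_nat.
have M0 : 0 < M%:R :> R by apply: lt_le_trans kM'.
rewrite natrD; set m : R := M%:R in M0 kM' *; set n : R := k%:R in k0 kM' *.
have N0 : 0 < m + n by rewrite addr_gt0.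
have a1 : m * (ln (m + n) - ln m) <= n.
  have := ln_sub_le M0 N0; rewrite ler_pdivlMr //; lra.
have a2 : n * (ln (m + n) - ln n) <= m.
  have := ln_sub_le k0 N0; rewrite ler_pdivlMr //; lra.
have b1 : 0 <= m * (ln (m + n) - ln m).
  by apply: mulr_ge0; rewrite ?subr_ge0 ?ler_ln ?posrE ?lerDl // ltW.
have b2 : 0 <= n * (ln (m + n) - ln n).
  by apply: mulr_ge0; rewrite ?subr_ge0 ?ler_ln ?posrE ?lerDr // ltW.
apply/andP; split; lra.
Qed.

Lemma near_xlnx_block (R : realType) (M K : nat) (v : R) : (0 < M)%N ->
  (K <= M)%N -> near_xlnx K v ->
  near_xlnx (M + K) (roots_potentialR M (pi / M%:R / 2) + v).
Proof.
move=> M0 KM; rewrite /near_xlnx.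
have /andP[x1 x2] := @xlnx_superadditive R M K KM.
have := @midpoint_value_asymp R M M0; set g := roots_potentialR _ _.
rewrite natrD in x1 x2 *; set D := _ - _ - _ in x1 x2.
have -> : (M%:R + K%:R) * ln (M%:R + K%:R) / pi =
   M%:R * ln M%:R / pi + K%:R * ln K%:R / pi + D / pi :> R.
  by rewrite /D; ring.
have d1 : 0 <= D / pi by rewrite divr_ge0 // pi_ge0.
have d2 : D / pi <= M%:R.
  rewrite ler_pdivrMr ?pi_gt0 //; apply: le_trans x2 _.
  by rewrite mulrC ler_wpM2l // pi_ge2.
rewrite !ler_norml => /andP[? ?] /andP[? ?]; apply/andP; split; lra.
Qed.

(** * The dyadic structure of greedy sequences *)

Definition angle_potential (R : realType) (t : nat -> R) (N : nat) (x : R) :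
    \bar R :=
  (\sum_(k < N) inv_chord (x - t k)%R)%E.

(** Greediness of the first N points only: this is what the tail of a greedy
    sequence inherits, and only up to the length of the preceding block. *)
Definition greedy_angles (R : realType) (t : nat -> R) (N : nat) : Prop :=
  forall n, (n < N)%N ->
    forall x, (angle_potential t n (t n) <= angle_potential t n x)%E.

Lemma greedy_angles_le (R : realType) (t : nat -> R) (N N' : nat) :
  (N' <= N)%N -> greedy_angles t N -> greedy_angles t N'.
Proof. by move=> le g n nN; apply: g; exact: leq_trans le. Qed.

Lemma angle_potential_ge0 (R : realType) (t : nat -> R) (N : nat) (x : R) :
  (0 <= angle_potential t N x)%E.
Proof. by apply: sume_ge0 => j _; exact: inv_chord_ge0. Qed.

Lemma angle_potentialD (R : realType) (t : nat -> R) (M K : nat) (x : R) :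
  angle_potential t (M + K) x =
  (angle_potential t M x + angle_potential (fun j => t (M + j)%N) K x)%E.
Proof. by rewrite /angle_potential big_split_ord. Qed.

(** Half-angles differing by a multiple of pi / 2^n: the points differ by a
    2^n-th root of unity. *)
Definition phase (R : realType) (n : nat) (t0 x : R) : Prop :=
  exists k : int, x = t0 + k%:~R * (pi / (2 ^ n)%:R).

(** That the first 2^n points are a rotated copy of the 2^n-th roots of unity is
    recorded through the potential only, which spares exhibiting the
    permutation. *)
Definition dyadic_block (R : realType) (n : nat) : Prop :=
  forall t : nat -> R, greedy_angles t (2 ^ n) ->
  forall x, angle_potential t (2 ^ n) x = roots_potential (2 ^ n) (x - t 0%N).

(** Besides the location of the minimisers, the induction has to produce one, so
    that no compactness argument is needed, and it carries the estimate of the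
    minimal value along.  For k = 0 the potential vanishes identically, hence the
    condition on the last clause. *)
Definition minimizers_on_grid (R : realType) (n : nat) : Prop :=
  forall (t : nat -> R) (k : nat), (k < 2 ^ n)%N -> greedy_angles t k ->
  exists x v,
    [/\ angle_potential t k x = v%:E,
        forall y, (v%:E <= angle_potential t k y)%E,
        near_xlnx k v,
        phase n (t 0%N) x &
        (0 < k)%N -> forall y, angle_potential t k y = v%:E ->
          phase n (t 0%N) y].

Lemma adde_min_eq (R : realType) (a b : \bar R) (g v : R) :
  (g%:E <= a)%E -> (v%:E <= b)%E -> (a + b <= (g + v)%:E)%E ->
  a = g%:E /\ b = v%:E.
Proof.
case: a => [a| |] //; case: b => [b| |] //; rewrite -?EFinD ?lee_fin => h1 h2 h3.
by split; congr EFin; lra.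
Qed.

Section DyadicStep.
Variables (R : realType) (n : nat).
Hypotheses (block : dyadic_block R n) (grid : minimizers_on_grid R n).
Let M := (2 ^ n)%N.
Let h : R := pi / M%:R.
Let g : R := roots_potentialR M (h / 2).
Let tail (t : nat -> R) j := t (M + j)%N.

Let M0 : (0 < M)%N. Proof. by rewrite expn_gt0. Qed.

Let roots_potential_phase (t0 x : R) (k : int) :
  x = t0 + (h / 2 + k%:~R * h) -> roots_potential M (x - t0) = g%:E.
Proof.
move=> ->; rewrite addrC addKr roots_potential_periodz // roots_potential_fin //.
by have : 0 < h; [rewrite divr_gt0 ?pi_gt0 // ltr0n | rewrite -/h; lra].
Qed.

Let second_block_start (t : nat -> R) : greedy_angles t M.+1 ->
  exists k : int, t M = t 0%N + (h / 2 + k%:~R * h).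
Proof.
move=> gt; have gtM : greedy_angles t M by apply: greedy_angles_le gt.
pose x := t 0%N + (h / 2 + 0%:~R * h).
have := gt M (ltnSn _) x.
rewrite !block // (@roots_potential_phase _ x 0) // => le.
have [ge /(_ _)[|k tk]] := roots_potential_min (t M - t 0%N) M0.
  by apply/eqP; rewrite eq_le le ge.
by exists k; rewrite -tk subrKC.
Qed.

Let roots_potential_tail (t : nat -> R) (x : R) : greedy_angles t M.+1 ->
  phase n (tail t 0%N) x -> roots_potential M (x - t 0%N) = g%:E.
Proof.
move=> /second_block_start[k tk] [i ->].
apply: (@roots_potential_phase _ _ (k + i)).
by rewrite /tail addn0 tk intrD -/h; ring.
Qed.

(** A point that is minimal for the tail alone lies on the grid where the
    potential of the first block is minimal too.  So the minimum of the sum is the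
    sum of the minima, and the greedy point attains both. *)
Let tail_greedy (t : nat -> R) (k : nat) : (k <= M)%N ->
  greedy_angles t (M + k) -> greedy_angles (tail t) k.
Proof.
elim: k => [//|k IH] kM gt.
have gk : greedy_angles (tail t) k.
  by apply: IH (ltnW kM) _; apply: greedy_angles_le gt; rewrite leq_add2l.
move=> j; rewrite ltnS leq_eqVlt => /predU1P[->|jk]; last exact: gk.
have [x [v [xv vmin _ xph _]]] := grid kM gk.
have gM : greedy_angles t M by apply: greedy_angles_le gt; exact: leq_addr.
have gM1 : greedy_angles t M.+1.
  by apply: greedy_angles_le gt; rewrite addnS ltnS leq_addr.
have := gt (M + k)%N; rewrite addnS => /(_ (ltnSn _) x).
rewrite !angle_potentialD xv !block // (roots_potential_tail gM1 xph) => le.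
have [_ e] := adde_min_eq (roots_potential_min _ M0).1 (vmin (tail t k)) le.
by move=> y; rewrite e.
Qed.

(** For k = 0 any midpoint works; for k > 0 a minimiser for the tail does. *)
Let common_minimizer (t : nat -> R) (k : nat) : (k < M)%N ->
  greedy_angles t (M + k) ->
  exists x v, [/\ roots_potential M (x - t 0%N) = g%:E,
    angle_potential (tail t) k x = v%:E,
    forall y, (v%:E <= angle_potential (tail t) k y)%E & near_xlnx k v].
Proof.
case: k => [_ _|k kM gt].
  exists (t 0%N + (h / 2 + 0%:~R * h)), 0; split.
  - exact: roots_potential_phase.
  - by rewrite /angle_potential big_ord0.
  - by move=> y; exact: angle_potential_ge0.
  - by rewrite /near_xlnx !mulr0 !mul0r subrr normr0.
have [x [v [xv vmin near xph _]]] := grid kM (tail_greedy (ltnW kM) gt).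
exists x, v; split=> //; apply: roots_potential_tail xph.
by apply: greedy_angles_le gt; rewrite addnS ltnS leq_addr.
Qed.

Let h_half : h = 2 * (pi / (2 ^ n.+1)%:R).
Proof.
have Mn : M%:R != 0 :> R by rewrite pnatr_eq0 -lt0n.
by rewrite /h expnS natrM -/M; move: (pi) => p; field.
Qed.

Let phase_refine (t0 x : R) (a k : int) :
  x = t0 + (a%:~R * (h / 2) + k%:~R * h) -> phase n.+1 t0 x.
Proof.
by move=> ->; exists (a + 2 * k); rewrite h_half intrD intrM; field.
Qed.

Lemma dyadic_block_succ : dyadic_block R n.+1.
Proof.
move=> t; have E : (2 ^ n.+1 = M + M)%N by rewrite expnS mul2n addnn.
rewrite E => gt x.
have gM : greedy_angles t M by apply: greedy_angles_le gt; exact: leq_addr.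
have gM1 : greedy_angles t M.+1.
  by apply: greedy_angles_le gt; rewrite -addn1 leq_add2l.
have [k tk] := second_block_start gM1.
rewrite angle_potentialD block // (block (tail_greedy (leqnn _) gt)).
rewrite /tail addn0 addnn roots_potential_double //; congr (_ + _)%E.
rewrite tk -(@roots_potential_periodz R M (x - t 0%N + _) (- 1 - k)) //.
congr roots_potential.
by rewrite -addnn -E -/h h_half intrD !intrN; move: (pi / _) => d; field.
Qed.

(** Whenever the first block is complete, being minimal for it already forces a
    point onto the refined grid. *)
Lemma minimizers_on_grid_succ : minimizers_on_grid R n.+1.
Proof.
move=> t k; rewrite expnS mul2n -addnn => kM gt.
have [kltM|Mk] := ltnP k M.
  have refine y : phase n (t 0%N) y -> phase n.+1 (t 0%N) y.
    by move=> [i ->]; apply: (@phase_refine _ _ 0 i); rewrite mul0r add0r.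
  have [x [v [xv vmin near xph yph]]] := grid kltM gt.
  by exists x, v; split=> // [|k0 y /(yph k0)]; exact: refine.
rewrite -(subnKC Mk) in kM gt *; rewrite ltn_add2l in kM.
set k' := (k - M)%N in kM gt *.
have gM : greedy_angles t M by apply: greedy_angles_le gt; exact: leq_addr.
have [x [v [pot_x xv vmin near]]] := common_minimizer kM gt.
have onphase y : roots_potential M (y - t 0%N) = g%:E -> phase n.+1 (t 0%N) y.
  move=> pot_y; have [i yi] := (roots_potential_min _ M0).2 pot_y.
  apply: (@phase_refine _ _ 1 i).
  by rewrite mul1r -yi subrKC.
exists x, (g + v); split.
- by rewrite angle_potentialD block // pot_x xv EFinD.
- move=> y; rewrite angle_potentialD block // EFinD leeD //.
  by have [] := roots_potential_min (y - t 0%N) M0.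
- exact: near_xlnx_block (ltnW kM) near.
- exact: onphase.
- move=> _ y; rewrite angle_potentialD block // => e; apply: onphase.
  have le : (roots_potential M (y - t 0%N)%R + angle_potential (tail t) k' y
             <= (g + v)%:E)%E by rewrite e.
  exact: (adde_min_eq (roots_potential_min _ M0).1 (vmin y) le).1.
Qed.

End DyadicStep.

Lemma greedy_dyadic_structure (R : realType) (n : nat) :
  dyadic_block R n /\ minimizers_on_grid R n.
Proof.
elim: n => [|n [block grid]]; last first.
  by split; [exact: dyadic_block_succ | exact: minimizers_on_grid_succ].
split=> [t _ x|t [|//] _ _].
  by rewrite /angle_potential /roots_potential !big_ord1 mul0r addr0.
exists (t 0%N), 0; split=> //.
- by rewrite /angle_potential big_ord0.
- by move=> y; exact: angle_potential_ge0.
- by rewrite /near_xlnx !mulr0 !mul0r subrr normr0.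
- by exists 0; rewrite mul0r addr0.
Qed.

(** Any dyadic scale exceeding N will do; 2^N is one. *)
Lemma greedy_value_asymp (R : realType) (t : nat -> R) (N : nat) :
  greedy_angles t N.+1 ->
  exists2 v, angle_potential t N (t N) = v%:E & near_xlnx N v.
Proof.
move=> gt; have [_ grid] := greedy_dyadic_structure R N.
have gN : greedy_angles t N by apply: greedy_angles_le gt.
have [x [v [xv vmin near _ _]]] := grid t N (ltn_expl N (ltnSn 1)) gN.
exists v => //; apply/eqP; rewrite eq_le vmin andbT -xv.
exact: gt.
Qed.

(** * From the circle to angles, and the limit *)

Definition circle_point (R : realType) (x : R) : R[i] :=
  (cos (2 * x) +i* sin (2 * x))%C.

Lemma circle_point_on (R : realType) (x : R) : unit_circle (circle_point x).
Proof. by rewrite /unit_circle /= cos2Dsin2 sqrtr1. Qed.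

Lemma circle_point_surj (R : realType) (z : R[i]) : unit_circle z ->
  exists x, z = circle_point x.
Proof.
case: z => a b; rewrite /unit_circle /= => e.
have e2 : a ^+ 2 + b ^+ 2 = 1.
  have := sqr_sqrtr (addr_ge0 (sqr_ge0 a) (sqr_ge0 b)).
  by rewrite e expr1n => <-.
have a1 : -1 <= a <= 1.
  rewrite -ler_norml -(@ler_pXn2r _ 2) ?nnegrE // expr1n real_normK ?num_real //.
  by have := sqr_ge0 b; lra.
have ac : cos (acos a) = a by rewrite acosK // in_itv /= a1.
have as_ : sin (acos a) = `|b|.
  rewrite sin_acos // -sqrtr_sqr; congr Num.sqrt; lra.
have [b0|b0] := leP 0 b.
- exists (acos a / 2); rewrite /circle_point mulrC divfK // ac as_.
  by rewrite ger0_norm.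
- exists (- acos a / 2); rewrite /circle_point mulrC divfK // cosN sinN ac as_.
  by rewrite ltr0_norm // opprK.
Qed.

(** This formula is the reason for parametrising the circle by half-angles. *)
Lemma normc_circle_pointB (R : realType) (x y : R) :
  ComplexField.Normc.normc (circle_point x - circle_point y) =
  2 * `|sin (x - y)|.
Proof.
rewrite /circle_point /ComplexField.Normc.normc /=.
rewrite (_ : _ + _ = (2 * sin (x - y)) ^+ 2).
  by rewrite sqrtr_sqr normrM ger0_norm.
have e : (sin (x - y)) ^+ 2 *+ 2 = 1 - cos ((x - y) *+ 2).
  by rewrite cos_mulr2n cos2sin2; ring.
have -> : (2 * sin (x - y)) ^+ 2 = 2 * (sin (x - y) ^+ 2 *+ 2) by ring.
rewrite e (_ : (x - y) *+ 2 = 2 * x - 2 * y); last by ring.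
rewrite cosB; have := cos2Dsin2 (2 * x); have := cos2Dsin2 (2 * y); lra.
Qed.

Lemma potential1_circle_point (R : realType) (a : nat -> R[i]) (t : nat -> R) :
  (forall k, a k = circle_point (t k)) -> forall N x,
  potential1 a N (circle_point x) = angle_potential t N x.
Proof.
move=> at_ N x; apply: eq_bigr => k _.
by rewrite at_ normc_circle_pointB.
Qed.

Lemma greedy_sequence_angles (R : realType) (a : nat -> R[i]) :
  greedy_1_energy_sequence a ->
  exists2 t : nat -> R, forall k, a k = circle_point (t k) &
    forall N, greedy_angles t N.
Proof.
move=> [onC gr].
have [t at_] := choice (fun k => circle_point_surj (onC k)).
exists t => // N [|n] _ x; first by rewrite /angle_potential !big_ord0.
rewrite -!(potential1_circle_point at_) -at_ gr //.
apply: ereal_inf_lbound; exists (circle_point x) => //.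
exact: circle_point_on.
Qed.

Lemma near_xlnx_cvg (R : realType) (v : nat -> R) :
  (forall N, near_xlnx N (v N)) ->
  (v N / (N%:R * ln N%:R)) @[N --> \oo] --> (pi : R)^-1.
Proof.
move=> nearv; apply/cvgrPdist_le => e e0.
near=> N.
have lnN : 3 / e <= ln (N%:R : R).
  near: N.
  exists (Num.truncn (expR (3 / e))).+1 => // N /= hN.
  have hN' : expR (3 / e) <= N%:R.
    apply: ltW; apply: lt_le_trans (truncnS_gt _) _.
    by rewrite ler_nat.
  rewrite -(expRK (3 / e)) ler_ln ?posrE ?expR_gt0 //.
  exact: lt_le_trans (expR_gt0 _) hN'.
have ln0 : 0 < ln (N%:R : R) by apply: lt_le_trans lnN; rewrite divr_gt0.
have N0 : 0 < N%:R :> R.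
  by rewrite ltr0n lt0n; apply: contraTneq ln0 => ->; rewrite ln0 ?ltxx.
have d0 : 0 < N%:R * ln N%:R :> R by rewrite mulr_gt0.
have -> : pi^-1 - v N / (N%:R * ln N%:R) =
   - (v N - N%:R * ln N%:R / pi) / (N%:R * ln N%:R) :> R.
  by have := pi_gt0 R; move: (pi) => p p0; field; rewrite !gt_eqF.
rewrite normrM normrN normfV (gtr0_norm d0) ler_pdivrMr //.
apply: le_trans (nearv N) _.
move: lnN; rewrite ler_pdivrMr // => lnN.
by rewrite mulrCA [X in X <= _]mulrC ler_pM2l // mulrC.
Unshelve. all: by end_near.
Qed.

Theorem theorem1p5 (R : realType) (a : nat -> R[i])
  (ha : greedy_1_energy_sequence a) :
  (potential1 a N (a N) / (N%:R * ln (N%:R))%:E)%E @[N --> \oo]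
    --> ((pi : R)^-1)%:E.
Proof.
have [t at_ gt] := greedy_sequence_angles ha.
have /choice[v vP] N :
    exists v, angle_potential t N (t N) = v%:E /\ near_xlnx N v.
  by have [v ? ?] := greedy_value_asymp (gt N.+1); exists v.
have quotient : \forall N \near \oo,
    (potential1 a N (a N) / (N%:R * ln (N%:R : R))%:E)%E =
    (v N / (N%:R * ln N%:R))%:E.
  exists 2%N => // N /= N2.
  rewrite at_ (potential1_circle_point at_) (vP N).1 inver ifF //.
  by apply: gt_eqF; rewrite mulr_gt0 ?ln_gt0 ?ltr0n ?ltr1n // (ltn_trans _ N2).
apply/fine_cvgP; split; first by near=> N; rewrite (near quotient N).
apply: cvg_trans (near_xlnx_cvg (fun N => (vP N).2)).
by apply: near_eq_cvg; near=> N; rewrite /= (near quotient N).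
Unshelve. all: by end_near.
Qed.
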